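(* Let $\zeta_1,\zeta_2,\zeta_3,\zeta_4$ be the four complex roots $\frac{1}{\sqrt2}(\pm1\pm i)$ of $x^4+1$. Let $g(x)\in\mathbb{Z}[x]$ be such that $g(\zeta_j)\ne 0$ for $j=1,2,3,4$, and let $W$ be the curve $y^2=(x^4+1)g(x)$. Set $W_+(\mathbb{Z})=\{(a,b)\in W(\mathbb{Z}): b>0\}$. Then $$|W_+(\mathbb{Z})|\le 2^{\omega(N)+1},$$ where $N=\prod_{j=1}^{4}g(\zeta_j)$ and $\omega(N)$ is the number of prime divisors of $N$.
   Context: $W(\mathbb{Z})$ denotes the set of integer points $(x,y)\in\mathbb{Z}^2$ of $W$. The number $N$ is a non-zero integer, and $\omega(N)$ counts the distinct primes dividing $N$. *)

(* Defs.v *)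
From HB Require Import structures.
From mathcomp Require Import all_boot all_order all_algebra.
From mathcomp Require Import mathcomp_extra boolp classical_sets functions cardinality reals.
From mathcomp Require Import complex.
From mathcomp Require Import ring.

Set Implicit Arguments.
Unset Strict Implicit.
Unset Printing Implicit Defensive.

Import Order.TTheory GRing.Theory Num.Theory.
Local Open Scope ring_scope.
Local Open Scope complex_scope.
Local Open Scope classical_set_scope.

(* The index s is the pair of signs, [true] standing for -1, so that
   s ranges over the four roots (1 / sqrt 2) (+-1 +- i). *)
Definition zeta (R : realType) (s : bool * bool) : R[i] :=
  ((Num.sqrt 2)^-1)%:C * ((-1) ^+ s.1 + (-1) ^+ s.2 * 'i%C).

Lemma zeta_roots (R : realType) :
  'X^4 + 1 = \prod_(s : bool * bool) ('X - (zeta R s)%:P).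
Proof.
have rw (F : bool * bool -> {poly R[i]}) : \prod_s F s =
    F (true, true) * F (true, false) * (F (false, true) * F (false, false)).
  rewrite (eq_bigr (fun s => F (s.1, s.2))); last by case.
  by rewrite -(pair_bigA _ (fun a b => F (a, b))) /= !big_bool.
rewrite rw /zeta /= !expr0 !expr1.
set c := _%:C.
have hc : c ^+ 2 * 2 = 1.
  have -> : 2 = (2 : R)%:C :> R[i] by rewrite rmorph_nat.
  by rewrite /c -rmorphXn -rmorphM /= exprVn sqr_sqrtr ?ler0n // mulVf ?pnatr_eq0.
have hi : ('i%C : R[i]) ^+ 2 = -1 by rewrite sqr_i.
clearbody c; move: 'i%C hi => i hi.
have hc' : c%:P ^+ 2 * 2 = 1 :> {poly R[i]}.
  by rewrite -[RHS]polyC1 -hc polyCM polyC_exp (rmorph_nat (@polyC _)).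
have hi' : i%:P ^+ 2 = -1 :> {poly R[i]}.
  by rewrite -polyC_exp hi polyCN.
rewrite !(polyCM, polyCD, polyCN) polyC1.
move: (c%:P) (i%:P) hc' hi' => C I hC hI.
rewrite [RHS](_ : _ =
    ('X^2 + C ^+ 2 * (1 - I ^+ 2)) ^+ 2 - 2 * (C ^+ 2 * 2) * 'X^2); last by ring.
rewrite hI; have -> : C ^+ 2 * (1 - -1) = C ^+ 2 * 2 by ring.
by rewrite hC; ring.
Qed.

Definition W_int (g : {poly int}) : set (int * int) :=
  [set p | p.2 ^+ 2 = (p.1 ^+ 4 + 1) * g.[p.1]].

Definition W_plus (g : {poly int}) : set (int * int) :=
  [set p | W_int g p /\ 0 < p.2].

Definition omega (N : int) : nat := size (primes `|N|%N).

(* Main.v *)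
(* If b > 0 and b^2 = (a^4+1) g(a), the primes of odd exponent in a^4+1 divide N, so
a^4+1 = d z^2 with d a product of distinct primes dividing N. It is enough to see that d
determines a^2, since then (d, sign of a) determines (a, b).

Let a^4+1 = d z^2 and b^4+1 = d w^2. Euclid's algorithm on the solutions of X^2 - d Y^2
= -1 gives t^4+1 = d u^2 with t = gcd(a, b), and the same descent gives a^2 + k i =
(t^2+i) y^2 with k = +-1 and y a Gaussian integer. So a + y sqrt(t^2+i) is a unit of
Z[i][sqrt(t^2+i)], and a descent shows it is, up to a root of unity and conjugation, a
power of t + sqrt(t^2+i). This makes a equal, up to a unit of Z[i], to t (U_(n+1) +
U_n), where U is the Lucas sequence with parameters (2 + w, 1), w = -4it^2. For n > 0 a
2-adic estimate shows that U_(n+1) + U_n is neither real nor purely imaginary. Hence n =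
0 and a^2 = t^2, and likewise b^2 = t^2. *)
Require Import Defs.
From mathcomp Require Import all_boot all_order all_algebra.
From mathcomp Require Import classical_sets cardinality reals complex.
From mathcomp Require Import zify ring lra.

Set Implicit Arguments.
Unset Strict Implicit.
Unset Printing Implicit Defensive.

Import Order.TTheory GRing.Theory Num.Theory.
Local Open Scope ring_scope.
Local Open Scope complex_scope.
Local Open Scope classical_set_scope.
Local Open Scope card_scope.

(** * The negative Pell equation *)

(* With e = g + u sqrt d, this multiplies x + y sqrt d by e^(-2), which keeps the norm
   -1 and changes x by a multiple of g. *)
Lemma pell_step (d g u x y : int) : 0 < g -> g < x -> 0 < u -> 0 < y ->
  g ^+ 2 + 1 = d * u ^+ 2 -> x ^+ 2 + 1 = d * y ^+ 2 ->
  exists x' y' c : int,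
  [/\ x' ^+ 2 + 1 = d * y' ^+ 2, (`|x'| < `|x|)%N, x' != 0, x' = c * g + x &
      x = x' * (2 * g ^+ 2 + 1) + 2 * g * d * u * y'].
Proof.
move=> g0 gx u0 y0 hg hx.
set x' := x * (2 * g ^+ 2 + 1) - 2 * g * d * u * y.
set y' := y * (2 * g ^+ 2 + 1) - 2 * g * u * x.
exists x', y', (2 * g * x - 2 * d * u * y).
have x0 : 0 < x by exact: lt_trans gx.
have g2 : 0 < g ^+ 2 by rewrite exprn_gt0.
have gx2 : g ^+ 2 < x ^+ 2 by rewrite ltr_pXn2r // nnegrE ltW.
have hd : 0 < d.
  by rewrite -(pmulr_lgt0 _ (exprn_gt0 2 u0)) -hg addr_gt0.
have hxy : x' ^+ 2 + 1 = d * y' ^+ 2.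
  have e : 4 * g ^+ 2 * (d * u ^+ 2) * (d * y ^+ 2 - x ^+ 2) =
     4 * g ^+ 2 * (g ^+ 2 + 1) by rewrite -hg -hx; ring.
  have e2 : (2 * g ^+ 2 + 1) ^+ 2 * (x ^+ 2 - d * y ^+ 2) = - (2 * g ^+ 2 + 1) ^+ 2.
    by rewrite -hx; ring.
  rewrite /x' /y'; lra.
set z := d * u * y.
have z0 : 0 < z by rewrite !mulr_gt0.
have hz : z ^+ 2 = (g ^+ 2 + 1) * (x ^+ 2 + 1) by rewrite hg hx /z; ring.
have x'E : x' = x * (2 * g ^+ 2 + 1) - 2 * g * z by rewrite /x' /z; ring.
(* This amounts to [x' < x], and [lt2] to [- x < x']. Both follow by comparing squares; the second
   one needs [g < x]. *)
have lt1 : x * g < z.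
  rewrite -(ltr_pXn2r (n := 2)) ?nnegrE //; [|by rewrite mulr_ge0 // ltW|exact: ltW].
  by rewrite hz exprMn; lra.
have lt2 : g * z < x * (g ^+ 2 + 1).
  rewrite -(ltr_pXn2r (n := 2)) ?nnegrE //.
  - rewrite exprMn hz exprMn.
    have -> : (g ^+ 2 + 1) ^+ 2 = (g ^+ 2 + 1) * (g ^+ 2 + 1) by ring.
    rewrite mulrCA [ltRHS]mulrCA ltr_pM2l ?addr_gt0 //.
    by lra.
  - by rewrite mulr_ge0 // ltW.
  - by rewrite mulr_ge0 ?addr_ge0 // ltW.
have lt3 : x * g * g < z * g by rewrite ltr_pM2r.
split=> //.
- have [lo hi] : - x < x' /\ x' < x by rewrite x'E; split; lra.
  by lia.
(* If [x' = 0] then [d = 1], and the square [u ^+ 2 = g ^+ 2 + 1] would lie strictly between two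
   consecutive squares. *)
- apply/eqP => x'0; move: hxy; rewrite x'0 expr0n /= add0r => hd1.
  have d1 : d = 1.
    have: (d %| 1)%Z by rewrite [X in (_ %| X)%Z]hd1 dvdz_mulr.
    rewrite dvdz1; lia.
  move: hg; rewrite d1 mul1r => hg.
  have gu : g < u by rewrite -(ltr_pXn2r (n := 2)) ?nnegrE ?ltW // -hg ltrDl.
  have : (g + 1) ^+ 2 <= u ^+ 2 by rewrite ler_pXn2r ?nnegrE ?lezD1 // ?addr_ge0 // ltW.
  by rewrite -hg; lra.
- by rewrite /x'; ring.
- rewrite /x' /y'.
  have : 4 * g ^+ 2 * x * (d * u ^+ 2) = 4 * g ^+ 2 * x * (g ^+ 2 + 1) by rewrite hg.
  lra.
Qed.

(** Euclid's algorithm: [pell_step], with the smaller solution as [g], replaces the larger one by a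
    smaller non-zero solution congruent to it modulo the smaller. The gcd is kept until the two
    solutions agree. *)
Lemma pell_gcd (d x y x' y' : int) : 0 < x -> 0 < x' ->
  x ^+ 2 + 1 = d * y ^+ 2 -> x' ^+ 2 + 1 = d * y' ^+ 2 ->
  exists u, gcdz x x' ^+ 2 + 1 = d * u ^+ 2.
Proof.
have [n] := ubnP (`|x| + `|x'|)%N.
elim: n x y x' y' => // n IHn x y x' y' hn x0 x'0.
wlog lexx' : x y x' y' hn x0 x'0 / x <= x'.
  move=> W hx hx'; have [le|lt] := leP x x'; first exact: (W _ y _ y').
  rewrite gcdzC; apply: (W _ y' _ y) => //; last exact: ltW.
  by rewrite addnC.
move: lexx'; rewrite le_eqVlt => /predU1P[<- hx _ | ltxx' hx hx'].
  by exists y; rewrite gcdzz gtz0_abs.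
wlog y0 : y hx / 0 < y.
  move=> W; have [y0|y0|y0] := ltgtP y 0.
  - by apply: (W (- y)); rewrite ?sqrrN ?oppr_gt0.
  - exact: (W y).
  - by move: hx; rewrite y0; nia.
wlog y'0 : y' hx' / 0 < y'.
  move=> W; have [y'0|y'0|y'0] := ltgtP y' 0.
  - by apply: (W (- y')); rewrite ?sqrrN ?oppr_gt0.
  - exact: (W y').
  - by move: hx'; rewrite y'0; nia.
have [x'' [y'' [c [hx'' lt'' x''n0 x''E _]]]] := pell_step x0 ltxx' y0 y'0 hx hx'.
have [u hu] : exists u, gcdz x `|x''| ^+ 2 + 1 = d * u ^+ 2.
  apply: (IHn x y _ y''); rewrite ?normr_gt0 ?real_normK ?num_real //; lia.
exists u; rewrite -hu; congr (_ ^+ 2 + 1).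
rewrite /gcdz absz_id -/(gcdz x x'').
by rewrite x''E gcdzMDl.
Qed.

(* In Z[i]: x + k i = (g + i) (a + b i)^2. *)
Lemma pell_gauss (d g u x y : int) : 0 < g -> (g %| x)%Z -> x != 0 ->
  g ^+ 2 + 1 = d * u ^+ 2 -> x ^+ 2 + 1 = d * y ^+ 2 ->
  exists a b k : int, [/\ k ^+ 2 = 1,
    x = g * (a ^+ 2 - b ^+ 2) - 2 * a * b &
    k = a ^+ 2 - b ^+ 2 + 2 * g * a * b].
Proof.
move=> g0.
wlog u0 : u / 0 < u.
  move=> W gx xn0 hg; have [u0|u0|u0] := ltgtP u 0.
  - by apply: (W (- u)); rewrite ?sqrrN ?oppr_gt0.
  - exact: (W u).
  - by move: hg; rewrite u0; nia.
have [n] := ubnP `|x|%N.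
elim: n x y => // n IHn x y hn gx xn0 hg hx.
wlog x0 : x hn gx xn0 hx / 0 < x.
  move=> W; have [x0|x0|x0] := ltgtP x 0.
  - have [a [b [k [hk hxE hkE]]]] : exists a b k : int, [/\ k ^+ 2 = 1,
      - x = g * (a ^+ 2 - b ^+ 2) - 2 * a * b &
      k = a ^+ 2 - b ^+ 2 + 2 * g * a * b].
      by apply: W; rewrite ?abszN ?dvdzN ?oppr_eq0 ?sqrrN ?oppr_gt0 // dvdzE abszN.
    exists (- b), a, (- k); split; rewrite ?sqrrN //; first by rewrite -[LHS]opprK hxE; ring.
    by rewrite hkE; ring.
  - exact: W.
  - by rewrite x0 in xn0.
wlog y0 : y hx / 0 < y.
  move=> W; have [y0|y0|y0] := ltgtP y 0.
  - by apply: (W (- y)); rewrite ?sqrrN ?oppr_gt0.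
  - exact: (W y).
  - by move: hx; rewrite y0; nia.
have [gltx|] := ltP g x; last first.
  have [c xE] := dvdzP gx => lexg.
  have c0 : 0 < c by move: x0; rewrite xE pmulr_lgt0.
  have c1 : c <= 1 by rewrite -(ler_pM2r g0) mul1r -xE.
  have -> : x = g by rewrite xE (_ : c = 1) ?mul1r //; lia.
  by exists 1, 0, 1; split; ring.
have [x' [y' [c [hx' lt' x'n0 x'E' xE]]]] := pell_step g0 gltx u0 y0 hg hx.
have gx' : (g %| x')%Z.
  by rewrite x'E' rpredD ?dvdz_mull.
have hn' : (`|x'| < n)%N by lia.
have [a [b [k [hk x'E kE]]]] := IHn x' y' hn' gx' x'n0 hg hx'.
have dn0 : d != 0 by apply/eqP => d0; move: hg; rewrite d0; nia.
(* Norms in x' + k i = (g + i) z^2, z = a + b i, determine [y'] up to sign. The two signs lead to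
   the new roots g z + (g - i) conj(z) and g z - (g - i) conj(z). *)
have : y' ^+ 2 = (u * (a ^+ 2 + b ^+ 2)) ^+ 2.
  apply: (mulfI dn0); rewrite -hx' -[1 in LHS]hk x'E kE.
  have -> : d * (u * (a ^+ 2 + b ^+ 2)) ^+ 2 = (d * u ^+ 2) * (a ^+ 2 + b ^+ 2) ^+ 2 by ring.
  by rewrite -hg; ring.
move/eqP; rewrite eqf_sqr.
case/orP => /eqP y'E.
  exists (2 * g * a - b), (- a), (- k); split; rewrite ?sqrrN //.
    rewrite xE y'E.
    have -> : 2 * g * d * u * (u * (a ^+ 2 + b ^+ 2)) =
        2 * g * (d * u ^+ 2) * (a ^+ 2 + b ^+ 2) by ring.
    by rewrite -hg x'E; ring.
  by rewrite kE; ring.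
exists b, (2 * g * b + a), (- k); split; rewrite ?sqrrN //.
  rewrite xE y'E.
  have -> : 2 * g * d * u * - (u * (a ^+ 2 + b ^+ 2)) =
      - (2 * g * (d * u ^+ 2) * (a ^+ 2 + b ^+ 2)) by ring.
  by rewrite -hg x'E; ring.
by rewrite kE; ring.
Qed.

(** * Units of Z[i][sqrt(t^2+i)] *)

(* ((r, d), (r', d')) stands for (U_n, U_(n+1)) = (r + d w, r' + d' w), where U_0 = 0,
   U_1 = 1, U_(n+2) = (2 + w) U_(n+1) - U_n and w^2 = -16 T^2. *)
Fixpoint lucas (T : int) (n : nat) : (int * int) * (int * int) :=
  if n is n'.+1 then
    let: ((r, d), (r', d')) := lucas T n' in
    ((r', d'), (2 * r' - 16 * T ^+ 2 * d' - r, 2 * d' + r' - d))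
  else ((0, 0), (1, 0)).

Lemma sqr_eq1 (k : int) : k ^+ 2 = 1 -> k = 1 \/ k = -1.
Proof. by move/eqP; rewrite sqrf_eq1 => /orP[] /eqP; [left|right]. Qed.

(* In Z[i], for x = a + b i, y = u + v i and A = t^2 + i, the equations say x^2 - A y^2
   = k i. The new first component is that of (x + y sqrt A) l for l = 1 - 2it^2 - 2it
   sqrt A (e = 1) or its inverse (e = -1). The two choices x1, x2 satisfy x1 x2 = x^2 -
   4 t^2 A k i, while |x1|^2 + |x2|^2 is about 16 t^4 |x|^2, so one of them is smaller
   than x. *)
Lemma descent_step_bound (t a b u v k : int) : 0 < t -> k ^+ 2 = 1 ->
  a ^+ 2 - b ^+ 2 = t ^+ 2 * (u ^+ 2 - v ^+ 2) - 2 * u * v ->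
  2 * a * b = u ^+ 2 - v ^+ 2 + 2 * t ^+ 2 * u * v + k ->
  4 * t ^+ 2 <= a ^+ 2 + b ^+ 2 ->
  exists2 e : int, e ^+ 2 = 1 &
    (a + 2 * t ^+ 2 * b + e * (2 * t * (t ^+ 2 * v + u))) ^+ 2 +
    (b - 2 * t ^+ 2 * a - e * (2 * t * (t ^+ 2 * u - v))) ^+ 2 <
    a ^+ 2 + b ^+ 2.
Proof.
move=> t0 k1 h1 h2 hn.
set n := a ^+ 2 + b ^+ 2 in hn *.
pose p e := a + 2 * t ^+ 2 * b + e * (2 * t * (t ^+ 2 * v + u)).
pose q e := b - 2 * t ^+ 2 * a - e * (2 * t * (t ^+ 2 * u - v)).
have [lt1|le1] := ltP (p 1 ^+ 2 + q 1 ^+ 2) n; first by exists 1.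
have [lt2|le2] := ltP (p (-1) ^+ 2 + q (-1) ^+ 2) n; first by exists (-1).
exfalso.
set X := a ^+ 2 - b ^+ 2 in h1; set Y := 2 * a * b in h2.
set m := u ^+ 2 + v ^+ 2.
set T := t ^+ 2 in h1 h2 hn *.
have T1 : 1 <= T by rewrite /T; nia.
have hXY : X ^+ 2 + Y ^+ 2 = n ^+ 2 by rewrite /X /Y /n; ring.
have n0 : 0 <= n by rewrite addr_ge0 ?sqr_ge0.
have hX : `|X| <= n.
  by rewrite -(ler_pXn2r (n := 2)) ?nnegrE // real_normK ?num_real // -hXY lerDl sqr_ge0.
have hY : `|Y| <= n.
  by rewrite -(ler_pXn2r (n := 2)) ?nnegrE // real_normK ?num_real // -hXY lerDr sqr_ge0.
have F2 : p 1 ^+ 2 + q 1 ^+ 2 + (p (-1) ^+ 2 + q (-1) ^+ 2) =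
    2 * (4 * T ^+ 2 + 1) * n + 8 * T * ((T ^+ 2 + 1) * m).
  by rewrite /p /q /n /m /T; ring.
have hre : p 1 * p (-1) - q 1 * q (-1) = X + 4 * T * k.
  rewrite (_ : _ - _ = (1 - 4 * T ^+ 2) * X + 4 * T * Y + 4 * T *
     (T * (T * (u ^+ 2 - v ^+ 2) - 2 * u * v) - (u ^+ 2 - v ^+ 2 + 2 * T * u * v + k) + k)).
    by rewrite -h1 -h2; ring.
  by rewrite /p /q /X /Y /T; ring.
have him : p 1 * q (-1) + q 1 * p (-1) = Y - 4 * T ^+ 2 * k.
  rewrite (_ : _ + _ = (1 - 4 * T ^+ 2) * Y - 4 * T * X + 4 * T *
     (T * (u ^+ 2 - v ^+ 2 + 2 * T * u * v + k) - T * k + (T * (u ^+ 2 - v ^+ 2) - 2 * u * v))).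
    by rewrite -h1 -h2; ring.
  by rewrite /p /q /X /Y /T; ring.
have F3 : (p 1 ^+ 2 + q 1 ^+ 2) * (p (-1) ^+ 2 + q (-1) ^+ 2) =
   n ^+ 2 + 8 * T * (k * X) - 8 * T ^+ 2 * (k * Y) + (16 * T ^+ 2 + 16 * T ^+ 4) * k ^+ 2.
  rewrite (_ : _ * _ = (p 1 * p (-1) - q 1 * q (-1)) ^+ 2 + (p 1 * q (-1) + q 1 * p (-1)) ^+ 2).
    by rewrite hre him -hXY; ring.
  ring.
(* The norm of A y^2 = x^2 - k i. Since [k * Y <= n], it bounds |y|^2 from below, as recorded in
   [hm]. *)
have F1 : (T ^+ 2 + 1) * m ^+ 2 = n ^+ 2 - 2 * (k * Y) + 1.
  transitivity (X ^+ 2 + Y ^+ 2 - 2 * (k * Y) + k ^+ 2); last by rewrite k1 hXY.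
  rewrite (_ : _ * _ = (T * (u ^+ 2 - v ^+ 2) - 2 * u * v) ^+ 2 +
     (u ^+ 2 - v ^+ 2 + 2 * T * u * v + k - k) ^+ 2); last by rewrite /m; ring.
  by rewrite -h1 -h2; ring.
have [hkX hkY hkY'] : [/\ k * X <= n, - (k * Y) <= n & k * Y <= n].
  move: hX hY; rewrite !ler_norml => /andP[X1 X2] /andP[Y1 Y2].
  by case: (sqr_eq1 k1) => ->; split; lra.
have m0 : 0 <= m by rewrite addr_ge0 ?sqr_ge0.
have hm : T * (n - 1) <= (T ^+ 2 + 1) * m.
  rewrite -(ler_pXn2r (n := 2)) ?nnegrE //.
  - have -> : ((T ^+ 2 + 1) * m) ^+ 2 = (T ^+ 2 + 1) * ((T ^+ 2 + 1) * m ^+ 2) by ring.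
    rewrite F1 exprMn.
    have h : (n - 1) ^+ 2 <= n ^+ 2 - 2 * (k * Y) + 1 by lra.
    apply: le_trans (_ : (T ^+ 2 + 1) * (n - 1) ^+ 2 <= _).
      by rewrite mulrDl lerDl mul1r sqr_ge0.
    by rewrite ler_pM2l // ltr_wpDl ?sqr_ge0.
  - by rewrite mulr_ge0 //; lra.
  - by rewrite mulr_ge0 // addr_ge0 ?sqr_ge0.
(* If neither choice is smaller than x, this product is non-negative. Once expanded, its negative
   part, of order 16 T^2 n^2, outweighs the rest because n >= 4 T. *)
have : 0 <= (p 1 ^+ 2 + q 1 ^+ 2 - n) * (p (-1) ^+ 2 + q (-1) ^+ 2 - n).
  by rewrite mulr_ge0 // subr_ge0.
have -> : (p 1 ^+ 2 + q 1 ^+ 2 - n) * (p (-1) ^+ 2 + q (-1) ^+ 2 - n) =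
  (p 1 ^+ 2 + q 1 ^+ 2) * (p (-1) ^+ 2 + q (-1) ^+ 2) -
  n * (p 1 ^+ 2 + q 1 ^+ 2 + (p (-1) ^+ 2 + q (-1) ^+ 2)) + n ^+ 2 by ring.
rewrite F3 F2 k1.
have T0 : 0 < T by lra.
have b1 : T * (k * X) <= T * n by rewrite ler_pM2l.
have b2 : T ^+ 2 * - (k * Y) <= T ^+ 2 * n by rewrite ler_pM2l // exprn_gt0.
have b3 : n * T * (T * (n - 1)) <= n * T * ((T ^+ 2 + 1) * m).
  by rewrite ler_wpM2l // mulr_ge0 // ltW.
have b4 : T * (2 * T * n ^+ 2) > T * (2 * T * n + n + 2 * T ^+ 3 + 2 * T).
  rewrite ltr_pM2l //.
  have : 4 * T * (T * n) <= n * (T * n) by rewrite ler_wpM2r // mulr_ge0 // ltW.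
  have : 1 * n <= T * n by rewrite ler_wpM2r.
  have : 1 * (T * n) <= T * (T * n) by rewrite ler_wpM2r // mulr_ge0 // ltW.
  have : T ^+ 2 * (4 * T) <= T ^+ 2 * n by rewrite ler_wpM2l // sqr_ge0.
  have : 1 * T ^+ 2 <= T * T ^+ 2 by rewrite ler_wpM2r // sqr_ge0.
  have : 1 * T <= T * T by rewrite ler_wpM2r // ltW.
  have : 0 < T * T by rewrite mulr_gt0.
  have : 0 < T ^+ 2 * T by rewrite !mulr_gt0.
  lra.
lra.
Qed.

(* By parity |u + v i|^2 is 1 mod 4; if it were at least 4, then |a + b i|^2 >= 4 t^2. *)
Lemma descent_base (t a b u v k : int) : 0 < t -> k ^+ 2 = 1 ->
  a ^+ 2 - b ^+ 2 = t ^+ 2 * (u ^+ 2 - v ^+ 2) - 2 * u * v ->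
  2 * a * b = u ^+ 2 - v ^+ 2 + 2 * t ^+ 2 * u * v + k ->
  a ^+ 2 + b ^+ 2 < 4 * t ^+ 2 -> u ^+ 2 + v ^+ 2 = 1.
Proof.
move=> t0 k1 h1 h2 hn.
have sqr_mod4 (x : int) : exists x' r : int, x ^+ 2 = 4 * x' + r /\ (r = 0 \/ r = 1).
  have [y [r [-> hr]]] : exists y r : int, x = 2 * y + r /\ (r = 0 \/ r = 1).
    by exists (x %/ 2)%Z, (x %% 2)%Z; lia.
  by exists (y ^+ 2 + y * r), r; split=> //; case: hr => ->; ring.
have [c mE] : exists c, u ^+ 2 + v ^+ 2 = 4 * c + 1.
  have [u' [r [hu hr]]] := sqr_mod4 u; have [v' [s [hv hs]]] := sqr_mod4 v.
  exists (u' + v'); rewrite hu hv.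
  move: h2; rewrite hu hv -!mulrA; move: (a * b) (t * _) => w w'.
  by case: (sqr_eq1 k1) => ->; move: hr hs; clear; lia.
have c0 : 0 <= c.
  have := addr_ge0 (sqr_ge0 u) (sqr_ge0 v); rewrite mE; clear; lia.
suff c_lt1 : c < 1 by rewrite mE; move: c0 c_lt1; clear; lia.
rewrite ltNge; apply/negP => c1.
have hm : 4 <= u ^+ 2 + v ^+ 2 by rewrite mE; move: c1; clear; lia.
set T := t ^+ 2 in h1 h2 hn *.
set m := u ^+ 2 + v ^+ 2 in hm.
set n := a ^+ 2 + b ^+ 2 in hn *.
have T0 : 0 < T by rewrite exprn_gt0.
have F1 : (T ^+ 2 + 1) * m ^+ 2 = n ^+ 2 - 2 * (k * (2 * a * b)) + 1.
  transitivity ((a ^+ 2 - b ^+ 2) ^+ 2 + (2 * a * b) ^+ 2 -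
      2 * (k * (2 * a * b)) + k ^+ 2); last first.
    by rewrite k1 /n; ring.
  rewrite (_ : _ * _ = (T * (u ^+ 2 - v ^+ 2) - 2 * u * v) ^+ 2 +
     (u ^+ 2 - v ^+ 2 + 2 * T * u * v + k - k) ^+ 2); last by rewrite /m; ring.
  by rewrite -h1 -h2; ring.
have hk : - (k * (2 * a * b)) <= n.
  have := sqr_ge0 (a + b); have := sqr_ge0 (a - b).
  by rewrite /n; case: (sqr_eq1 k1) => ->; lra.
have n0 : 0 <= n by rewrite addr_ge0 ?sqr_ge0.
have : (n + 1) ^+ 2 <= 16 * T ^+ 2.
  rewrite (_ : 16 * T ^+ 2 = (4 * T) ^+ 2); last by ring.
  rewrite ler_pXn2r ?nnegrE ?lezD1 //; lra.
have : (T ^+ 2 + 1) * 16 <= (T ^+ 2 + 1) * m ^+ 2.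
  rewrite (_ : 16 = 4 ^+ 2) // ler_pM2l ?ler_pXn2r ?nnegrE // ?(le_trans _ hm) //.
  by rewrite ltr_wpDl ?sqr_ge0.
rewrite F1; lra.
Qed.

Lemma sqr_eq_unit (x y : int) : (x * y) ^+ 2 = 1 -> x ^+ 2 = y ^+ 2.
Proof.
rewrite exprMn; move: (sqr_ge0 x) (sqr_ge0 y).
move: (x ^+ 2) (y ^+ 2) => p q; clear=> p0 q0 pq.
have p1 : 1 <= p by nia.
have q1 : 1 <= q by nia.
by nia.
Qed.

(* In Z[i]: x = z t (U_(n+1) + U_n) and y = e z (U_(n+1) - U_n), where w = -4it^2 and z
   = z1 + z2 i is a unit. *)
Lemma gauss_descent (t a b u v k : int) : 0 < t -> k ^+ 2 = 1 ->
  a ^+ 2 - b ^+ 2 = t ^+ 2 * (u ^+ 2 - v ^+ 2) - 2 * u * v ->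
  2 * a * b = u ^+ 2 - v ^+ 2 + 2 * t ^+ 2 * u * v + k ->
  exists n r d r' d', lucas (t ^+ 2) n = ((r, d), (r', d')) /\
  exists z1 z2 e : int,
    [/\ z1 ^+ 2 + z2 ^+ 2 = 1, e ^+ 2 = 1,
        a = t * (z1 * (r' + r) + z2 * (4 * t ^+ 2 * (d' + d))) /\
        b = t * (z2 * (r' + r) - z1 * (4 * t ^+ 2 * (d' + d))),
        u = e * (z1 * (r' - r) + z2 * (4 * t ^+ 2 * (d' - d))) &
        v = e * (z2 * (r' - r) - z1 * (4 * t ^+ 2 * (d' - d)))].
Proof.
move=> t0 k1.
have [N] := ubnP `|(a ^+ 2 + b ^+ 2)%R|%N.
elim: N a b u v => // N IHN a b u v hN h1 h2.
have [small|big] := ltP (a ^+ 2 + b ^+ 2) (4 * t ^+ 2).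
  have m1 := descent_base t0 k1 h1 h2 small.
  have uv : (u ^+ 2 = 1 /\ v = 0) \/ (u = 0 /\ v ^+ 2 = 1).
    by move: m1; clear; nia.
  have T0 : 0 < t ^+ 2 by rewrite exprn_gt0.
  exists 0%N, 0, 0, 1, 0; split=> //.
  have sqr_t x : x ^+ 2 = t ^+ 2 -> exists2 z : int, z ^+ 2 = 1 & x = t * z.
    move/eqP; rewrite eqf_sqr => /orP[] /eqP ->.
      by exists 1; rewrite ?mulr1.
    by exists (-1); rewrite ?mulrN1.
  (* Here y is a unit: y = 1 or -1 forces x = t or -t, and y = i or -i forces x = i t or -i t. Hence
     z = x / t and e = y / z, with n = 0. *)
  case: uv => -[hu hv].
    have [b0 a2] : b = 0 /\ a ^+ 2 = t ^+ 2.
      move: h1 h2; rewrite hu hv; case: (sqr_eq1 k1) => -> h1 h2.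
        have ab1 : a * b = 1 by lra.
        have : a ^+ 2 = b ^+ 2 by apply: sqr_eq_unit; rewrite ab1 ?sqrrN.
        by lra.
      have /eqP : a * b = 0 by lra.
      rewrite mulf_eq0 => /orP[] /eqP h0; move: h1; rewrite h0 => h1; last by split; lra.
      by have := sqr_ge0 b; lra.
    have [z z1 az] := sqr_t _ a2.
    exists z, 0, (u * z); rewrite hv b0 az; split; try split; try ring.
    - by rewrite expr0n addr0.
    - by rewrite exprMn hu z1 mulr1.
    - by rewrite !subr0 mulr1 mul0r addr0 -mulrA -expr2 z1 mulr1.
  have [a0 b2] : a = 0 /\ b ^+ 2 = t ^+ 2.
    move: h1 h2; rewrite hu hv; case: (sqr_eq1 k1) => -> h1 h2; last first.
      have ab1 : a * b = -1 by lra.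
      have : a ^+ 2 = b ^+ 2 by apply: sqr_eq_unit; rewrite ab1 ?sqrrN.
      by lra.
    have /eqP : a * b = 0 by lra.
    rewrite mulf_eq0 => /orP[] /eqP h0; move: h1; rewrite h0 => h1; first by split; lra.
    by have := sqr_ge0 a; lra.
  have [z z1 bz] := sqr_t _ b2.
  exists 0, z, (v * z); rewrite hu a0 bz; split; try split; try ring.
  - by rewrite expr0n add0r.
  - by rewrite exprMn hv z1 mulr1.
  - by rewrite !subr0 mulr1 mul0r subr0 -mulrA -expr2 z1 mulr1.
have [e0 e01] := descent_step_bound t0 k1 h1 h2 big.
set a' := a + _ + _; set b' := b - _ - _ => lt'.
pose u' := u + 2 * t ^+ 2 * v + e0 * (2 * t * b).
pose v' := v - 2 * t ^+ 2 * u - e0 * (2 * t * a).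
have h1' : a' ^+ 2 - b' ^+ 2 = t ^+ 2 * (u' ^+ 2 - v' ^+ 2) - 2 * u' * v'.
  transitivity (a ^+ 2 - b ^+ 2 - (t ^+ 2 * (u ^+ 2 - v ^+ 2) - 2 * u * v) +
     (t ^+ 2 * (u' ^+ 2 - v' ^+ 2) - 2 * u' * v')); last by rewrite h1; ring.
  by rewrite /a' /b' /u' /v'; case: (sqr_eq1 e01) => ->; ring.
have h2' : 2 * a' * b' = u' ^+ 2 - v' ^+ 2 + 2 * t ^+ 2 * u' * v' + k.
  transitivity (2 * a * b - (u ^+ 2 - v ^+ 2 + 2 * t ^+ 2 * u * v + k) +
     (u' ^+ 2 - v' ^+ 2 + 2 * t ^+ 2 * u' * v' + k)); last by rewrite h2; ring.
  by rewrite /a' /b' /u' /v'; case: (sqr_eq1 e01) => ->; ring.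
have hN' : (`|(a' ^+ 2 + b' ^+ 2)%R| < N)%N.
  have := addr_ge0 (sqr_ge0 a') (sqr_ge0 b').
  move: lt' hN; move: (a' ^+ 2 + _) (a ^+ 2 + _); clear; lia.
have [n [r [d [r' [d' [luE [z1 [z2 [e [hz he [a'E b'E] u'E v'E]]]]]]]]]] := IHN _ _ _ _ hN' h1' h2'.
(* The descent step is undone by multiplying by the inverse of l or by l itself. *)
have aE : a = a' + 2 * t ^+ 2 * b' - e0 * (2 * t * (t ^+ 2 * v' + u')).
  by rewrite /a' /b' /u' /v'; case: (sqr_eq1 e01) => ->; ring.
have bE : b = b' - 2 * t ^+ 2 * a' + e0 * (2 * t * (t ^+ 2 * u' - v')).
  by rewrite /a' /b' /u' /v'; case: (sqr_eq1 e01) => ->; ring.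
have uE : u = u' + 2 * t ^+ 2 * v' - e0 * (2 * t * b').
  by rewrite /a' /b' /u' /v'; case: (sqr_eq1 e01) => ->; ring.
have vE : v = v' - 2 * t ^+ 2 * u' + e0 * (2 * t * a').
  by rewrite /a' /b' /u' /v'; case: (sqr_eq1 e01) => ->; ring.
clearbody a' b' u' v'.
(* Undoing the step raises the Lucas index by one if [e0 = - e] and lowers it by one if [e0 = e]. *)
have [e0E|e0E] : e0 = - e \/ e0 = e.
  by case: (sqr_eq1 e01) => ->; case: (sqr_eq1 he) => ->; [right|left|left|right].
  exists n.+1, r', d', (2 * r' - 16 * (t ^+ 2) ^+ 2 * d' - r), (2 * d' + r' - d).
  split; first by rewrite /= luE.
  exists z1, z2, e; rewrite aE bE uE vE e0E a'E b'E u'E v'E; split=> //.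
  - by split; case: (sqr_eq1 he) => ->; ring.
  - by case: (sqr_eq1 he) => ->; ring.
  - by case: (sqr_eq1 he) => ->; ring.
(* Below index 0 comes U_(-1) = -1; the pair (-1, 0) is expressed by index 0 again, with z and e
   negated. *)
case: n luE => [[rE dE r'E d'E] | n /=].
  exists 0%N, 0, 0, 1, 0; split=> //.
  exists (- z1), (- z2), (- e); rewrite aE bE uE vE e0E a'E b'E u'E v'E !sqrrN.
  rewrite -rE -dE -r'E -d'E; split=> //.
  - by split; case: (sqr_eq1 he) => ->; ring.
  - by case: (sqr_eq1 he) => ->; ring.
  - by case: (sqr_eq1 he) => ->; ring.
case luE: (lucas _ n) => [[s f] [s' f']] [rE dE r'E d'E].
exists n, s, f, s', f'; split=> //.
exists z1, z2, e; rewrite aE bE uE vE e0E a'E b'E u'E v'E -rE -dE -r'E -d'E; split=> //.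
- by split; case: (sqr_eq1 he) => ->; ring.
- by case: (sqr_eq1 he) => ->; ring.
- by case: (sqr_eq1 he) => ->; ring.
Qed.

(** * Two-adic estimate *)

(* Components of U_(n+1)^2 - (2 + w) U_n U_(n+1) + U_n^2 = 1. *)
Lemma lucas_norm (T : int) n r d r' d' : lucas T n = ((r, d), (r', d')) ->
  r' ^+ 2 + r ^+ 2 - 2 * r * r' + 16 * T ^+ 2 *
    (2 * d * d' + r * d' + d * r' - d' ^+ 2 - d ^+ 2) = 1 /\
  2 * r' * d' + 2 * r * d - 2 * (r * d' + d * r') - r * r' + 16 * T ^+ 2 * d * d' = 0.
Proof.
elim: n r d r' d' => [|n IHn] r d r' d' /= .
  by case=> <- <- <- <-; split; ring.
case: (lucas T n) IHn => [[s f] [s' f']] IHn [<- <- <- <-].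
have [h1 h2] := IHn _ _ _ _ erefl.
by split; [rewrite -[RHS]h1|rewrite -[RHS]h2]; ring.
Qed.

(* U_2n = U_n V_n and U_(2n+1) = U_(n+1)^2 - U_n^2, where p + q w = V_n = 2 U_(n+1) - (2
   + w) U_n. *)
Lemma lucas_double (T : int) n r d r' d' : lucas T n = ((r, d), (r', d')) ->
  let p := 2 * r' - 2 * r + 16 * T ^+ 2 * d in
  let q := 2 * d' - 2 * d - r in
  lucas T n.*2 =
    ((r * p - 16 * T ^+ 2 * d * q, r * q + d * p),
     (r' ^+ 2 - r ^+ 2 - 16 * T ^+ 2 * (d' ^+ 2 - d ^+ 2), 2 * r' * d' - 2 * r * d)).
Proof.
elim: n r d r' d' => [|n IHn] r d r' d' /=.
  by case=> <- <- <- <- /=; congr ((_, _), (_, _)); ring.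
case: (lucas T n) IHn => [[s f] [s' f']] IHn [<- <- <- <-].
by rewrite (IHn _ _ _ _ erefl); congr ((_, _), (_, _)); ring.
Qed.

(** Modulo 2 the recurrence for the real components reduces to r_(n+2) = r_n, since w^2 is even. *)
Lemma lucas_mod2 (T : int) n r d r' d' : lucas T n = ((r, d), (r', d')) ->
  exists x x', r = n%:Z + 2 * x /\ r' = n%:Z + 1 + 2 * x'.
Proof.
elim: n r d r' d' => [|n IHn] r d r' d' /=.
  by case=> <- _ <- _; exists 0, 0.
case: (lucas T n) IHn => [[s f] [s' f']] IHn [<- _ <- _].
have [x [x' [-> ->]]] := IHn _ _ _ _ erefl.
exists x', (2 * x' - 8 * T ^+ 2 * f' - x).
by rewrite intS; split; ring.
Qed.

(* The last two equations are about the components of V_n = 2 U_(n+1) - (2 + w) U_n. *)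
Lemma lucas_two_adic (T : int) (e m : nat) r d r' d' : odd m ->
  lucas T (m * 2 ^ e)%N = ((r, d), (r', d')) ->
  exists x y z c : int,
    [/\ r = 2 ^+ e * (2 * x + 1), 2 * d = 2 ^+ e * y,
        2 * r' - 2 * r + 16 * T ^+ 2 * d = 2 + 4 * z &
        2 * d' - 2 * d - r = 4 ^+ e * c].
Proof.
move=> modd; elim: e r d r' d' => [|e IHe] r d r' d'.
  rewrite muln1 => luE; have [x [x' [rE r'E]]] := lucas_mod2 luE.
  have [k mE] : exists k : int, m%:Z = 2 * k + 1.
    by exists (m./2)%:Z; rewrite -[in LHS](odd_double_half m) modd; lia.
  exists (k + x), (2 * d), (x' - x + 4 * T ^+ 2 * d), (2 * d' - 2 * d - r).
  by split; rewrite ?expr0 ?mul1r // ?rE ?r'E mE; ring.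
rewrite expnS mulnCA mul2n.
case luE: (lucas T (m * 2 ^ e)%N) => [[s f] [s' f']].
have [x [y [z [c [sE fE pE qE]]]]] := IHe _ _ _ _ luE.
have [] := lucas_norm luE.
have [a aE] : exists a : int, a = 2 ^+ e by exists (2 ^+ e).
have [b bE] : exists b : int, b = 4 ^+ e by exists (4 ^+ e).
rewrite -aE in sE fE; rewrite -bE in qE.
set N1 := (X in X = 1); set N2 := (X in X = 0) => N1E N2E.
rewrite (lucas_double luE) pE qE => -[<- <- <- <-].
pose Q := 4 * T ^+ 2.
have hd : 16 * T ^+ 2 * f = a * (2 * Q * y).
  by rewrite (_ : _ * f = 8 * T ^+ 2 * (2 * f)); [rewrite fE /Q; ring | ring].
(* With [V2'], this is V_(2n) = V_n^2 - 2 in components. The second component 2 p q gains a factor 4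
   because p = 2 + 4 z is even. *)
have V2 : 2 * (s' ^+ 2 - s ^+ 2 - 16 * T ^+ 2 * (f' ^+ 2 - f ^+ 2)) -
  2 * (s * (2 + 4 * z) - 16 * T ^+ 2 * f * (b * c)) +
  16 * T ^+ 2 * (s * (b * c) + f * (2 + 4 * z)) =
  (2 + 4 * z) ^+ 2 - 16 * T ^+ 2 * (b * c) ^+ 2 - 2.
  transitivity ((2 + 4 * z) ^+ 2 - 16 * T ^+ 2 * (b * c) ^+ 2 - 2 * N1).
    by rewrite -pE -qE /N1; ring.
  by rewrite N1E mulr1.
have V2' : 2 * (2 * s' * f' - 2 * s * f) -
  2 * (s * (b * c) + f * (2 + 4 * z)) -
  (s * (2 + 4 * z) - 16 * T ^+ 2 * f * (b * c)) =
  2 * (2 + 4 * z) * (b * c).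
  transitivity (2 * (2 + 4 * z) * (b * c) - 2 * N2).
    by rewrite -pE -qE /N2; ring.
  by rewrite N2E mulr0 subr0.
exists (x + 2 * x * z + z - T ^+ 2 * y * (b * c) * 2),
  ((2 * x + 1) * (b * c) + y * (1 + 2 * z)),
  (4 * z + 4 * z ^+ 2 - 4 * T ^+ 2 * (b * c) ^+ 2), ((1 + 2 * z) * c).
split.
- by rewrite hd sE exprS -aE /Q; ring.
- rewrite exprS -aE (_ : 2 * _ = 2 * s * (b * c) + 2 * f * (2 + 4 * z)); last by ring.
  by rewrite fE sE; ring.
- by rewrite V2; ring.
- by rewrite V2' exprS -bE; ring.
Qed.

Lemma expr2_odd_neq0 (e : nat) (x y : int) : x = 2 ^+ e * (2 * y + 1) -> x != 0.
Proof.
by move=> ->; rewrite mulf_neq0 ?expf_neq0 //; clear; lia.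
Qed.

(** The first sum is odd. For the second, with n even, 2 (d' + d) is 4 d + r plus the second
    component of V_n; the former has the 2-adic valuation of n, the latter a larger one. For n odd
    the same is done at n + 1. *)
Lemma lucas_sum_neq0 (T : int) n r d r' d' : (0 < n)%N ->
  lucas T n = ((r, d), (r', d')) -> r' + r != 0 /\ d' + d != 0.
Proof.
move=> n0 luE; split.
  by have [x [x' [-> ->]]] := lucas_mod2 luE; clear; lia.
have even_case k s f s' f' : (0 < k)%N -> ~~ odd k -> lucas T k = ((s, f), (s', f')) ->
    exists e y z, 4 * f + s = 2 ^+ e * (2 * y + 1) /\ 2 * f' - 2 * f - s = 2 ^+ e * (2 * z).
  move=> k0 kev lukE.
  have [m mcop kE] := pfactor_coprime (isT : prime 2) k0.
  have modd : odd m by rewrite -coprime2n.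
  case eE: (logn 2 k) kE => [|e] kE.
    by move: kev; rewrite kE muln1 modd.
  rewrite kE in lukE.
  have [x [y [z [c [sE fE _ qE]]]]] := lucas_two_adic modd lukE.
  exists e.+1, (x + y), (2 ^+ e * c).
  rewrite (_ : 4 * f = 2 * (2 * f)); [rewrite qE fE sE | by ring].
  have -> : 4 ^+ e.+1 = 2 ^+ e.+1 * (2 * 2 ^+ e) :> int by rewrite -exprS -exprMn.
  by move: (2 ^+ e.+1) (2 ^+ e) => A B; split; ring.
apply/eqP => d0; have [odd_n|ev_n] := boolP (odd n); last first.
  have [e [y [z [h1 h2]]]] := even_case _ _ _ _ _ n0 ev_n luE.
  have /expr2_odd_neq0/eqP : 2 * (d' + d) = 2 ^+ e * (2 * (y + z) + 1).
    transitivity (4 * d + r + (2 * d' - 2 * d - r)); first by ring.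
    by rewrite h1 h2; ring.
  by rewrite d0 mulr0.
have luE' : lucas T n.+1 = ((r', d'), (2 * r' - 16 * T ^+ 2 * d' - r, 2 * d' + r' - d)).
  by rewrite /= luE.
have [|e [y [z [h1 h2]]]] := even_case _ _ _ _ _ (ltn0Sn n) _ luE'.
  by rewrite /= odd_n.
have /expr2_odd_neq0/eqP : 2 * (d' + d) = 2 ^+ e * (2 * (y - z) + 1).
  transitivity (4 * d' + r' - (2 * (2 * d' + r' - d) - 2 * d' - r')); first by ring.
  by rewrite h1 h2; ring.
by rewrite d0 mulr0.
Qed.

(** * Uniqueness of a^2 for given d *)

Lemma quartic_dvd_eq (d t c u w : int) : 0 < t -> (t %| c)%Z -> c != 0 ->
  t ^+ 4 + 1 = d * u ^+ 2 -> c ^+ 4 + 1 = d * w ^+ 2 -> c ^+ 2 = t ^+ 2.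
Proof.
move=> t0 tc cn0 ht hc.
have [p [q [k [k1 cE kE]]]] :
    exists p q k : int, [/\ k ^+ 2 = 1,
      c ^+ 2 = t ^+ 2 * (p ^+ 2 - q ^+ 2) - 2 * p * q &
      k = p ^+ 2 - q ^+ 2 + 2 * t ^+ 2 * p * q].
  apply: (@pell_gauss d (t ^+ 2) u (c ^+ 2) w).
  - by rewrite exprn_gt0.
  - by rewrite !expr2 dvdz_mul.
  - by rewrite expf_neq0.
  - by rewrite -exprM.
  - by rewrite -exprM.
(* The equations of [pell_gauss] say that c^2 + k i = (t^2 + i) (p + q i)^2, so the descent applies
   to the real number x = c, that is, with second component 0. *)
have [||| n [r [e [r' [e' [luE [z1 [z2 [s [hz _ [cE' /eqP]]]]]]]]]]] :=
  @gauss_descent t c 0 p q (- k) t0.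
- by rewrite sqrrN.
- by rewrite expr0n /= subr0.
- by rewrite mulr0 {1}kE; ring.
rewrite eq_sym mulf_eq0 gt_eqF //= => /eqP z0 _ _.
have zz : (z1 ^+ 2 = 1 /\ z2 = 0) \/ (z1 = 0 /\ z2 ^+ 2 = 1).
  by move: hz; clear; nia.
have T0 : 4 * t ^+ 2 != 0 by rewrite mulf_neq0 ?expf_neq0 ?gt_eqF.
(* As z is a unit and c is real, one component of U_(n+1) + U_n vanishes, which is impossible for n
   > 0. *)
case: n luE => [|n] luE; last first.
  have [N1 N2] := lucas_sum_neq0 (ltn0Sn n) luE.
  case: zz => -[h1 h2]; move: z0; rewrite ?h1 ?h2 mul0r ?sub0r ?subr0 => /eqP.
    have S0 := mulf_neq0 T0 N2.
    by rewrite oppr_eq0 mulf_eq0 (negPf S0) orbF -sqrf_eq0 h1.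
  by rewrite mulf_eq0 (negPf N1) orbF -sqrf_eq0 h2.
case: luE => rE eE r'E e'E.
move: cE' z0; rewrite -rE -eE -r'E -e'E !addr0 !mulr0 !addr0 mulr1 mulr1 => -> z20.
by move: hz; rewrite z20 expr0n /= addr0 exprMn => ->; rewrite mulr1.
Qed.

Lemma quartic_class_unique (d a b z w : int) : 0 <= d ->
  a ^+ 4 + 1 = d * z ^+ 2 -> b ^+ 4 + 1 = d * w ^+ 2 -> a ^+ 2 = b ^+ 2.
Proof.
move=> d0.
(* The gcd argument needs non-zero entries. If one of them is 0 then [d = 1], and two squares
   differing by 1 force the other to be 0. *)
have zero x y v : 1 = d * y ^+ 2 -> x ^+ 4 + 1 = d * v ^+ 2 -> x ^+ 2 = 0.
  move=> h1; have -> : d = 1.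
    have : (d %| 1)%Z by rewrite [X in (_ %| X)%Z]h1 dvdz_mulr.
    by rewrite dvdz1; move: d0; clear; lia.
  rewrite mul1r => hx.
  have : (x ^+ 2) ^+ 2 + 1 = v ^+ 2 by rewrite -exprM.
  have := sqr_ge0 x; move: (x ^+ 2) => s; rewrite -[v ^+ 2]real_normK ?num_real //.
  have := normr_ge0 v; move: `|v| => v'; clear=> v0 s0 hs.
  have : s < v' by nia.
  by nia.
have [->|an0] := eqVneq a 0.
  by rewrite [_ ^+ 4]expr0n add0r => h1 h2; rewrite (zero _ _ _ h1 h2) expr0n.
have [->|bn0] := eqVneq b 0.
  by rewrite [0 ^+ 4]expr0n add0r => h1 h2; rewrite (zero _ _ _ h2 h1) expr0n.
move=> ha hb; pose t := gcdz a b.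
have t0 : 0 < t by rewrite lt_def gcdz_eq0 (negPf an0).
have tE : gcdz (a ^+ 2) (b ^+ 2) = t ^+ 2.
  have ga := dvdz_gcdl a b; have gb := dvdz_gcdr a b; rewrite -/t in ga gb.
  have tn : `|t|%N = t :> int by rewrite gtz0_abs.
  have cop : coprimez (a %/ t)%Z (b %/ t)%Z.
    apply/eqP/(mulIf (lt0r_neq0 t0)).
    by rewrite -[X in _ * X]tn mulz_gcdl !divzK // mul1r.
  rewrite -{1}(divzK ga) -{1}(divzK gb) !exprMn -mulz_gcdl.
  rewrite (eqP (coprimezXl 2 (coprimezXr 2 cop))) mul1r gtz0_abs //.
  by rewrite exprn_gt0.
have [u] : exists u, gcdz (a ^+ 2) (b ^+ 2) ^+ 2 + 1 = d * u ^+ 2.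
  by apply: (@pell_gcd d _ z _ w); rewrite -?exprM // lt_def sqr_ge0 sqrf_eq0 ?an0 ?bn0.
rewrite tE -exprM => hu.
rewrite (quartic_dvd_eq t0 _ an0 hu ha) ?dvdz_gcdl //.
by rewrite (quartic_dvd_eq t0 _ bn0 hu hb) ?dvdz_gcdr.
Qed.

(** * Counting *)

(** The squarefree part of [n] is written over the fixed list [primes M], so that a family of
    parities indexed by this list determines it. *)
Lemma odd_part_mul_square (n M : nat) : (0 < n)%N ->
  (forall p, odd (logn p n) -> p \in primes M) ->
  exists m, n = ((\prod_(p <- primes M | odd (logn p n)) p) * m ^ 2)%N.
Proof.
move=> n0 hM; exists (\prod_(p <- primes n) p ^ (logn p n)./2)%N.
have -> : (\prod_(p <- primes M | odd (logn p n)) p =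
    \prod_(p <- primes n | odd (logn p n)) p)%N.
  rewrite -[LHS]big_filter -[RHS]big_filter; apply: perm_big.
  apply: uniq_perm; rewrite ?filter_uniq ?primes_uniq // => p.
  rewrite !mem_filter; case: (boolP (odd _)) => //= podd.
  by rewrite hM // -logn_gt0 odd_gt0.
rewrite {1}(prod_prime_decomp n0) prime_decompE big_map /= [in RHS]big_mkcond /=.
rewrite -mulnn -!big_split /=; apply: eq_bigr => p _.
rewrite -expnD addnn -[in LHS](odd_double_half (logn p n)) expnD.
by case: (odd _).
Qed.

(** * The product of g over the roots of x^4 + 1 *)

(** The product is even in [z], hence of the form C + D z^2 modulo z^4 + 1. The explicit cofactor
    lets it serve both at the roots and for integers modulo a^4 + 1. *)
Lemma cubic_mul_neg (A : comPzRingType) (r0 r1 r2 r3 z : A) :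
  let h x := r0 + r1 * x + r2 * x ^+ 2 + r3 * x ^+ 3 in
  h z * h (- z) = r0 ^+ 2 - r2 ^+ 2 + 2 * r1 * r3 +
    z ^+ 2 * (2 * r0 * r2 - r1 ^+ 2 + r3 ^+ 2) +
    (z ^+ 4 + 1) * (r2 ^+ 2 - 2 * r1 * r3 - r3 ^+ 2 * z ^+ 2).
Proof. by move=> h; rewrite /h; ring. Qed.

Lemma poly_mod_X4D1 (g : {poly int}) : exists q r0 r1 r2 r3,
  g = q * ('X^4 + 1) + (r0%:P + r1%:P * 'X + r2%:P * 'X^2 + r3%:P * 'X^3).
Proof.
have dE : ('X^4 + 1 : {poly int}) = 'X^4 + 1%:P by rewrite polyC1.
have dmonic : ('X^4 + 1 : {poly int}) \is monic by rewrite dE monicXnaddC.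
set r := Pdiv.Ring.rmodp g ('X^4 + 1).
exists (Pdiv.Ring.rdivp g ('X^4 + 1)), r`_0, r`_1, r`_2, r`_3.
rewrite {1}(Pdiv.RingMonic.rdivp_eq dmonic g) -/r; congr (_ + _).
have size_r : (size r <= 4)%N.
  have := Pdiv.Ring.ltn_rmodpN0 g (monic_neq0 dmonic).
  by rewrite dE size_XnaddC.
apply/polyP => i; rewrite !coefD !coefCM coefC coefX !coefXn.
case: i => [|[|[|[|i]]]] /=; rewrite ?mulr1 ?mulr0 ?addr0 ?add0r //.
by rewrite nth_default // (leq_trans size_r).
Qed.

Lemma zeta_sqr (R : realType) : zeta R (false, false) ^+ 2 = 'i%C /\
  zeta R (false, true) ^+ 2 = - 'i%C.
Proof.
rewrite /zeta /= !expr0 !expr1; set c := _%:C.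
have hc : c ^+ 2 * 2 = 1.
  have -> : 2 = (2 : R)%:C :> R[i] by rewrite rmorph_nat.
  by rewrite /c -rmorphXn -rmorphM /= exprVn sqr_sqrtr ?ler0n // mulVf ?pnatr_eq0.
have hi : ('i%C : R[i]) ^+ 2 = -1 by rewrite sqr_i.
clearbody c; move: 'i%C hi => i hi.
split.
  transitivity (c ^+ 2 * 2 * i + c ^+ 2 * (1 + i ^+ 2)); first by ring.
  by rewrite hc hi; ring.
transitivity (- (c ^+ 2 * 2 * i) + c ^+ 2 * (1 + i ^+ 2)); first by ring.
by rewrite hc hi; ring.
Qed.

Lemma zetaN (R : realType) (s1 s2 : bool) : zeta R (~~ s1, ~~ s2) = - zeta R (s1, s2).
Proof. by rewrite /zeta /= !signrN mulNr -opprD mulrN. Qed.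

(** The roots pair up as z and -z with z^2 = i or -i, so the product is (C + D i) (C - D i). *)
Lemma prod_zeta (R : realType) (q : {poly int}) (r0 r1 r2 r3 : int) :
  let g := q * ('X^4 + 1) + (r0%:P + r1%:P * 'X + r2%:P * 'X^2 + r3%:P * 'X^3) in
  \prod_(s : bool * bool) (map_poly intr g).[zeta R s] =
  ((r0 ^+ 2 - r2 ^+ 2 + 2 * r1 * r3) ^+ 2 +
   (2 * r0 * r2 - r1 ^+ 2 + r3 ^+ 2) ^+ 2)%:~R.
Proof.
move=> g.
pose h (x : R[i]) := r0%:~R + r1%:~R * x + r2%:~R * x ^+ 2 + r3%:~R * x ^+ 3.
have zeta4 s : zeta R s ^+ 4 + 1 = 0.
  have [h1 h2] := zeta_sqr R.
  have hi : ('i%C : R[i]) ^+ 2 = -1 by rewrite sqr_i.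
  rewrite (exprM _ 2 2); case: s => [[] []].
  - by rewrite (zetaN R false false) sqrrN h1 hi addNr.
  - by rewrite (zetaN R false true) sqrrN h2 sqrrN hi addNr.
  - by rewrite h2 sqrrN hi addNr.
  - by rewrite h1 hi addNr.
have gE s : (map_poly intr g).[zeta R s] = h (zeta R s).
  rewrite /g !(rmorphD, rmorphXn, rmorphM, rmorph1) /= !map_polyX !map_polyC /=.
  move: (zeta R s) (zeta4 s) => z z4.
  rewrite hornerD hornerM [('X^4 + 1).[z]]hornerD hornerXn hornerC z4 mulr0 add0r !hornerE.
  by rewrite /h !exprS expr0 mulr1 !mulrA.
have rw (F : bool * bool -> R[i]) : \prod_s F s =
    (F (false, false) * F (true, true)) * (F (false, true) * F (true, false)).
  rewrite (eq_bigr (fun s => F (s.1, s.2))); last by case.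
  rewrite -(pair_bigA _ (fun a b => F (a, b))) /= !big_bool.
  by rewrite -[LHS]/(F (true, true) * F (true, false) * (F (false, true) * F (false, false))); ring.
rewrite (eq_bigr _ (fun s _ => gE s)) rw (zetaN R false false) (zetaN R false true).
rewrite !cubic_mul_neg !zeta4 !mul0r !addr0.
have [-> ->] := zeta_sqr R.
have hi : ('i%C : R[i]) ^+ 2 = -1 by rewrite sqr_i.
rewrite !(rmorph_nat, rmorphB, rmorphD, rmorphXn, rmorphM) /=.
move: 'i%C hi => i hi.
set C := _ - _ + _; set D := 2 * _ * _ - _ + _.
transitivity (C ^+ 2 - i ^+ 2 * D ^+ 2); first by ring.
by rewrite hi mulN1r opprK.
Qed.

Theorem proposition3p11 (R : realType) (g : {poly int})
  (hg : forall s : bool * bool, (map_poly intr g).[zeta R s] <> 0) :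
  exists N : int,
    [/\ N <> 0,
        N%:~R = \prod_(s : bool * bool) (map_poly intr g).[zeta R s]
      & W_plus g #<= `I_(2 ^ (omega N + 1))%N].
Proof.
have [q [r0 [r1 [r2 [r3 gE]]]]] := poly_mod_X4D1 g.
pose C := r0 ^+ 2 - r2 ^+ 2 + 2 * r1 * r3; pose D := 2 * r0 * r2 - r1 ^+ 2 + r3 ^+ 2.
pose N := C ^+ 2 + D ^+ 2.
have NE : N%:~R = \prod_(s : bool * bool) (map_poly intr g).[zeta R s].
  by rewrite gE prod_zeta.
have N0 : N != 0.
  rewrite -(intr_eq0 R[i]) NE; apply/prodf_neq0 => s _; exact/eqP.
exists N; split=> //; first exact/eqP.
have dvdN (p a : int) : (p %| a ^+ 4 + 1)%Z -> (p %| g.[a])%Z -> (p %| N)%Z.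
  move=> pe pg.
  set e := a ^+ 4 + 1 in pe.
  pose h x := r0 + r1 * x + r2 * x ^+ 2 + r3 * x ^+ 3.
  have ph : (p %| h a)%Z.
    have : g.[a] = q.[a] * e + h a by rewrite gE !hornerE.
    by move/eqP; rewrite addrC -subr_eq => /eqP <-; rewrite rpredB ?dvdz_mull.
  (* Modulo e, h(a) h(-a) is C + D a^2, and (C + D a^2) (C - D a^2) = N - D^2 e. *)
  have -> : N = h a * (h (- a) * (C - a ^+ 2 * D)) +
      e * (D ^+ 2 - (r2 ^+ 2 - 2 * r1 * r3 - r3 ^+ 2 * a ^+ 2) * (C - a ^+ 2 * D)).
    by rewrite mulrA cubic_mul_neg /N -/C -/D /e; ring.
  by rewrite rpredD ?dvdz_mulr.
pose n (a : int) := `|(a ^+ 4 + 1)%R|%N.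
have nE a : (n a)%:Z = a ^+ 4 + 1.
  by rewrite /n gtz0_abs // ltr_wpDl // (exprM _ 2 2) sqr_ge0.
have n0 a : (0 < n a)%N by rewrite -ltz_nat nE ltr_wpDl // (exprM _ 2 2) sqr_ge0.
have odd_primes a b : W_plus g (a, b) -> forall p, odd (logn p (n a)) -> p \in primes `|N|.
  case=> /= hW b0 p podd.
  have np : p \in primes (n a) by rewrite -logn_gt0 odd_gt0.
  have bE : (`|b| ^ 2 = n a * `|g.[a]|)%N by rewrite -abszM -abszX hW.
  have b0' : (0 < `|b|)%N by rewrite absz_gt0 gt_eqF.
  have g0 : (0 < `|g.[a]|)%N.
    by rewrite lt0n; apply/eqP => g0; move: bE b0'; rewrite g0 muln0; case: (`|b|)%N.
  (* The valuations of a^4 + 1 and g(a) at p add up to an even number, so p also divides g(a). *)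
  have := congr1 (logn p) bE; rewrite lognX lognM // => logE.
  have podd' : odd (logn p `|g.[a]|%N).
    by have := congr1 odd logE; rewrite oddM oddD podd /= => /esym/negbFE.
  move: np; rewrite !mem_primes n0 => /andP[-> /= pn].
  rewrite absz_gt0 N0 /=; apply: (dvdN p a).
    by rewrite /= -nE.
  have : p \in primes `|g.[a]|%N by rewrite -logn_gt0 odd_gt0.
  by rewrite mem_primes => /and3P[].
pose T := (bool * (omega N).-tuple bool)%type.
(* The sign of a, and d encoded as one bit per prime of N. *)
pose f (ab : int * int) : T :=
  (ab.1 < 0, [tuple of [seq odd (logn p (n ab.1)) | p <- in_tuple (primes `|N|%N)]]).
pose F ab : nat := enum_rank (f ab).
have cardT : #|{: T}| = (2 ^ (omega N + 1))%N.
  by rewrite card_prod card_tuple card_bool addn1 expnS.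
have Finj : {in W_plus g &, injective F}.
  move=> [a b] [a' b']; rewrite !inE => hW hW' /ord_inj/enum_rank_inj.
  rewrite /f /= => -[signE /eq_in_map oddE].
  have [m mE] := odd_part_mul_square (n0 a) (odd_primes _ _ hW).
  have [m' m'E] := odd_part_mul_square (n0 a') (odd_primes _ _ hW').
  have sqE : a ^+ 2 = a' ^+ 2.
    apply: (@quartic_class_unique (\prod_(p <- primes `|N| | odd (logn p (n a))) p)%N%:Z _ _ m m').
    - by [].
    - by rewrite -nE {1}mE PoszM.
    - rewrite -nE {1}m'E PoszM; congr (Posz _ * _).
      rewrite big_seq_cond [RHS]big_seq_cond; apply: eq_bigl => p.
      by case: (boolP (_ \in _)) => //= /oddE ->.
  have aE : a = a'.
    by move/eqP: sqE; rewrite eqf_sqr => /orP[] /eqP aE //; move: signE; rewrite aE; clear; lia.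
  case: hW hW' => [hW b0] [hW' b'0]; congr pair => //.
  move: hW hW' b0 b'0; rewrite /W_int /= -aE => <- bE b0 b'0.
  by apply/eqP; rewrite -(eqrXn2 (n := 2)) ?ltW // bE.
rewrite -(card_le_eql (inj_card_eq Finj)).
apply: subset_card_le => _ [ab _ <-]; rewrite /= -cardT; exact: ltn_ord.
Qed.
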